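(* Let $u=2$, $v=4$ (so $t=2$, $u'=1$ in the notation of the context), let $\mathcal{A}=(\mathbb{Z}/4\mathbb{Z};\cdot)$ with $\imath\cdot\jmath:=(1-2\imath)\jmath$, and let $\Gamma$ be an additive abelian group. Then $$\mathrm{H}^2_N(\mathcal{A},\Gamma)\cong\mathrm{H}^2(\mathcal{X}(\mathcal{A},\Gamma))\cong\frac{\Gamma}{2\Gamma}\oplus\Gamma_{2}\oplus\Gamma_{2}.$$ Moreover, for $\gamma,\gamma_1,\gamma'_1\in\Gamma$ with $2\gamma'_1=0$ and $4\gamma_1=2\gamma$ put $z(\gamma_1,\gamma'_1,\gamma):=\bigl(f_1(\gamma),\ \imath\mapsto\gamma_{\imath},\ \imath\mapsto\imath\gamma'_1\bigr)$, where $\gamma_0=0$, $\gamma_2=2\gamma_1-\gamma$ and $\gamma_3=3\gamma_1-2\gamma$. Then the set $\overline{Z}:=\{z(\gamma_1,\gamma'_1,\gamma):2\gamma'_1=0,\ 4\gamma_1=2\gamma\}$ is a subgroup of the group $Z$ of $2$-cocycles of $\mathcal{X}(\mathcal{A},\Gamma)$ that maps surjectively onto $\mathrm{H}^2(\mathcal{X}(\mathcal{A},\Gamma))=Z/B$, one has $\overline{Z}\cap B=\{z(2\gamma,0,4\gamma):\gamma\in\Gamma\}$, and the map $\Theta\colon\overline{Z}\to\Gamma\oplus\Gamma_{2}\oplus\Gamma_{2}$, $\Theta(z(\gamma_1,\gamma'_1,\gamma)):=(\gamma_1,2\gamma_1-\gamma,\gamma'_1)$, is an isomorphism that induces an isomorphism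 $\mathrm{H}^2(\mathcal{X}(\mathcal{A},\Gamma))\cong\Gamma/2\Gamma\oplus\Gamma_{2}\oplus\Gamma_{2}$.
   Context: For $r\in\mathbb{N}$, $\Gamma_r:=\{\gamma\in\Gamma:r\gamma=0\}$. Throughout $u=2$, $v=4$, $t=2$, $u'=1$. $C_v=\langle g\rangle$ is the multiplicative cyclic group of order $v$ with $g^{\imath}\cdot g^{\jmath}:=g^{(1-u\imath)\jmath}$; $D=\mathbb{Z}[C_v]$, $\overline{D}=D/\mathbb{Z}1$. Normalized full cohomology $\mathrm{H}^*_N(\mathcal{A},\Gamma)$. For $s\ge1$ let $\overline{M}(s)$ be the quotient of $\overline{D}^{\otimes s}$ by the subgroup generated by the shuffles $\sum_{\sigma}\mathrm{sg}(\sigma)\,d_{\sigma^{-1}(1)}\otimes\cdots\otimes d_{\sigma^{-1}(s)}$, where $1\le l<s$, $d_k\in\overline{D}$ and $\sigma$ runs over the permutations with $\sigma(1)<\dots<\sigma(l)$ and $\sigma(l+1)<\dots<\sigma(s)$; $[\cdots]$ denotes classes. For $r\ge0,s\ge1$ let $\widehat{C}_{rs}=\overline{D}^{\otimes r}\otimes\overline{M}(s)$, with horizontal differential $\partial^{\mathrm h}(g_1\otimes\cdots\otimes g_r\otimes[g_{r+1}\otimes\cdots\otimes g_{r+s}])=g_1\cdot g_2\otimes\cdots\otimes g_1\cdot g_r\otimes[g_1\cdot g_{r+1}\otimes\cdots\otimes g_1\cdot g_{r+s}]+\sum_{j=1}^{r-1}(-1)^jg_1\otimes\cdots\otimes g_jg_{j+1}\otimes\cdots\otimes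 g_r\otimes[g_{r+1}\otimes\cdots\otimes g_{r+s}]+(-1)^rg_1\otimes\cdots\otimes g_{r-1}\otimes[g_{r+1}\otimes\cdots\otimes g_{r+s}]$ and vertical differential $\partial^{\mathrm v}(g_1\otimes\cdots\otimes g_r\otimes[g_{r+1}\otimes\cdots\otimes g_{r+s}])=(-1)^{r+1}g_1\otimes\cdots\otimes g_r\otimes[g_{r+2}\otimes\cdots\otimes g_{r+s}]+\sum_{j=r+1}^{r+s-1}(-1)^{j+1}g_1\otimes\cdots\otimes g_r\otimes[g_{r+1}\otimes\cdots\otimes g_jg_{j+1}\otimes\cdots\otimes g_{r+s}]+(-1)^{r+s+1}g_1\otimes\cdots\otimes g_r\otimes[g_{r+1}\otimes\cdots\otimes g_{r+s-1}]$. Then $\mathrm{H}^n_N(\mathcal{A},\Gamma)$ is the $n$-th cohomology of $\mathrm{Hom}_{\mathbb{Z}}(\mathrm{Tot}(\widehat{C}_{**}),\Gamma)$, where $\mathrm{Tot}_n=\bigoplus_{r+s=n}\widehat{C}_{rs}$ has differential $\partial^{\mathrm h}+\partial^{\mathrm v}$. The small complex $\mathcal{X}(\mathcal{A},\Gamma)$ in degree $2$. Its $1$-cochains are functions $\theta\colon\mathbb{Z}/v\to\Gamma$ with $\theta(0)=0$; its $2$-cochains are triples $(F,\alpha,\beta)$ with $F\colon\mathbb{Z}/v\times\mathbb{Z}/v\to\Gamma$ symmetric, $F(0,\cdot)=0$, and $\alpha,\beta\colon\mathbb{Z}/v\to\Gamma$ with $\alpha(0)=\beta(0)=0$. The group $B$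 of $2$-coboundaries consists of the triples $\bigl((\imath,\jmath)\mapsto\theta(\imath+\jmath)-\theta(\imath)-\theta(\jmath),\ \imath\mapsto\theta((1-u)\imath)-\theta(\imath),\ 0\bigr)$. The group $Z$ of $2$-cocycles consists of the triples satisfying, for all $a,b,c,\imath,\jmath\in\mathbb{Z}/v$: $F(b,c)-F(a+b,c)+F(a,b+c)-F(a,b)=0$; $\alpha(\imath)+\alpha(\jmath)-\alpha(\imath+\jmath)+F((1-u)\imath,(1-u)\jmath)-F(\imath,\jmath)=0$; $\beta(\imath+\jmath)=\beta(\imath)+\beta(\jmath)$; $\beta((1-u)\imath)=\beta(\imath)$; $u\beta(\imath)=0$; and $-\sum_{s=0}^{t-1}\alpha((1-su)\imath)-\beta(\imath)+u'\sum_{s=1}^{t-1}s\,\beta((1-su)\imath)=0$. $\mathrm{H}^2(\mathcal{X}(\mathcal{A},\Gamma))=Z/B$. For $\gamma\in\Gamma$, $f_1(\gamma)$ is the function on $\mathbb{Z}/4\times\mathbb{Z}/4$ given on representatives $0\le\imath,\jmath<4$ by $\gamma$ if $\imath=\jmath=1$, by $-\gamma$ if $\imath,\jmath\ge2$ and $\imath+\jmath\le 5$, and by $0$ otherwise. *)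

(* Defs.v *)
(* MathComp, with the classical layer of MathComp-Analysis. *)
From HB Require Import structures.
From mathcomp Require Import all_boot all_order all_fingroup all_algebra.
From mathcomp Require Import boolp classical_sets functions.

Set Implicit Arguments.
Unset Strict Implicit.
Unset Printing Implicit Defensive.

Import GRing.Theory.
Local Open Scope ring_scope.

Definition subgroup_closed (V : zmodType) (P : V -> Prop) :=
  P 0 /\ forall x y, P x -> P y -> P (x - y).

Fact addrBB (V : zmodType) (a b c d : V) : (a - b) + (c - d) = (a + c) - (b + d).
Proof. by rewrite opprD addrACA. Qed.

Fact subrBB (V : zmodType) (a b c d : V) : (a - b) - (c - d) = (a - c) - (b - d).
Proof. by rewrite !opprD !opprK addrACA. Qed.

Definition sgpred (V : zmodType) (P : V -> Prop) (hP : subgroup_closed P) :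
  {pred V} := fun v => `[< P v >].

Section SgPred.
Variables (V : zmodType) (P : V -> Prop) (hP : subgroup_closed P).

Lemma sgpredP v : reflect (P v) (v \in sgpred hP).
Proof. exact: asboolP. Qed.

Fact sgpred_zmod_closed : zmod_closed (sgpred hP).
Proof.
by split=> [|x y /sgpredP Px /sgpredP Py]; apply/sgpredP; case: hP; auto.
Qed.

HB.instance Definition _ :=
  GRing.isZmodClosed.Build V (sgpred hP) sgpred_zmod_closed.
End SgPred.

Definition subgroup (V : zmodType) (P : V -> Prop) (hP : subgroup_closed P) :
  zmodClosed V := sgpred hP.

Lemma subgroupP (V : zmodType) (P : V -> Prop) (hP : subgroup_closed P) v :
  reflect (P v) (v \in subgroup hP).
Proof. exact: sgpredP. Qed.

Definition subgroup_type (V : zmodType) (S : zmodClosed V) := {v : V | v \in S}.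

HB.instance Definition _ (V : zmodType) (S : zmodClosed V) :=
  SubChoice.on (subgroup_type S).
HB.instance Definition _ (V : zmodType) (S : zmodClosed V) :=
  [SubChoice_isSubZmodule of subgroup_type S by <:].

Section Subquotient.
Variables (V : zmodType) (Z B : zmodClosed V).

Fact restr_closed :
  subgroup_closed (fun z : subgroup_type Z => val z \in B).
Proof.
split=> [|x y xB yB]; first by rewrite raddf0 rpred0.
by rewrite raddfB rpredB.
Qed.

Definition restr : zmodClosed (subgroup_type Z) := subgroup restr_closed.

(* [Z / (B :&: Z)], that is [Z / B] when [B] is contained in [Z] *)
Definition subquotient := Quotient.quot restr.
HB.instance Definition _ := GRing.Zmodule.on subquotient.

Definition class_of (z : subgroup_type Z) : subquotient :=
  (\pi_(Quotient.quot restr) z)%qT.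
End Subquotient.

Section Generated.
Variables (V : zmodType) (X : V -> Prop).

Fact generated_closed : subgroup_closed (fun v =>
  forall P, subgroup_closed P -> (forall x, X x -> P x) -> P v).
Proof.
split=> [|x y hx hy] P hP XP; first by case: hP.
by case: (hP) => _ PB; apply: PB; [exact: hx | exact: hy].
Qed.

Definition generated : zmodClosed V := subgroup generated_closed.
End Generated.

Section TorsionAndMultiples.
Variables (G : zmodType) (r : nat).

Fact multiples_closed : subgroup_closed (fun x : G => exists y, x = y *+ r).
Proof.
split=> [|_ _ [x ->] [y ->]]; first by exists 0; rewrite mul0rn.
by exists (x - y); rewrite mulrnBl.
Qed.

Fact torsion_closed : subgroup_closed (fun x : G => x *+ r = 0).
Proof.
by split=> [|x y hx hy]; rewrite ?mul0rn // mulrnBl hx hy subrr.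
Qed.

Definition mod_multiples := Quotient.quot (subgroup multiples_closed).
HB.instance Definition _ := GRing.Zmodule.on mod_multiples.

Definition mod_class (x : G) : mod_multiples :=
  (\pi_(Quotient.quot (subgroup multiples_closed)) x)%qT.

Definition torsion := subgroup_type (subgroup torsion_closed).
HB.instance Definition _ := SubChoice.on torsion.
HB.instance Definition _ := GRing.SubZmodule.on torsion.
End TorsionAndMultiples.

Definition zmod_iso (U V : zmodType) : Prop :=
  exists f : {additive U -> V}, bijective f.

Section DirectSum.
Variables (I : finType) (V : I -> zmodType).

Definition dsum := {dffun forall i : I, V i}.
HB.instance Definition _ := Choice.on dsum.

Definition dsum0 : dsum := [ffun i => 0].
Definition dsum_opp (f : dsum) : dsum := [ffun i => - f i].
Definition dsum_add (f g : dsum) : dsum := [ffun i => f i + g i].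

Fact dsum_addA : associative dsum_add.
Proof. by move=> f g h; apply/ffunP => i; rewrite !ffunE addrA. Qed.
Fact dsum_addC : commutative dsum_add.
Proof. by move=> f g; apply/ffunP => i; rewrite !ffunE addrC. Qed.
Fact dsum_add0 : left_id dsum0 dsum_add.
Proof. by move=> f; apply/ffunP => i; rewrite !ffunE add0r. Qed.
Fact dsum_addN : left_inverse dsum0 dsum_opp dsum_add.
Proof. by move=> f; apply/ffunP => i; rewrite !ffunE addNr. Qed.

HB.instance Definition _ :=
  GRing.isZmodule.Build dsum dsum_addA dsum_addC dsum_add0 dsum_addN.
End DirectSum.

Local Notation u := 2%N.
Local Notation t := 2%N.
Local Notation u' := 1%N.

(* The element [g ^ i] of the multiplicative cyclic group [C_v], [v = 4], is
   encoded by its exponent [i : 'Z_4]: the group product is [+] and the group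
   unit is [0]. *)
Local Notation C := 'Z_4.

Definition dot (i j : C) : C := (1 - u%:R * i) * j.

Definition freeZ (T : finType) := {ffun T -> int}.
HB.instance Definition _ (T : finType) := GRing.Zmodule.on (freeZ T).

Definition delta (T : finType) (x : T) : freeZ T := [ffun y => (y == x)%:R].

Definition zlin (T : finType) (V : zmodType) (F : T -> V) (c : freeZ T) : V :=
  \sum_x F x *~ c x.

(* [D = Z[C_v]], and [D^{(x) n}], the free abelian group on [C_v ^ n] *)
Definition D := freeZ C.
Definition Dtens (n : nat) := freeZ {ffun 'I_n -> C}.
HB.instance Definition _ n := GRing.Zmodule.on (Dtens n).

Definition tens n (d : 'I_n -> D) : Dtens n :=
  [ffun x : {ffun 'I_n -> C} => \prod_k d k (x k)].

(* The permutations of the last [s = n - r] positions that are increasing on the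
   first [l] and on the last [s - l] of these. *)
Definition is_shuffle n (r l : nat) (sg : 'S_n) : bool :=
  [forall i : 'I_n, (i < r)%N ==> (sg i == i)] &&
  [forall i : 'I_n, forall j : 'I_n,
     [&& r <= i, i < j & (j < r + l) || (r + l <= i)]%N ==> (sg i < sg j)%N].

Definition shuffle n (r l : nat) (d : 'I_n -> D) : Dtens n :=
  \sum_(sg : 'S_n | is_shuffle r l sg)
     tens (fun k => d ((sg^-1)%g k)) *~ (-1) ^+ sg.

(* \overline{D}^{(x) r} (x) \overline{M}(s), with r + s = n, is presented as the
   quotient of D^{(x) n} by the tensors with an entry equal to the unit of C_v
   and the shuffles of the last s entries. *)
Inductive Chat_relator n (r : nat) : Dtens n -> Prop :=
| rel_unit (d : 'I_n -> D) (k : 'I_n) :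
    d k = delta 0 -> Chat_relator r (tens d)
| rel_shuffle (l : nat) (d : 'I_n -> D) :
    (0 < l)%N -> (r + l < n)%N -> Chat_relator r (shuffle r l d).

Definition Chat_rel n r : zmodClosed (Dtens n) := generated (@Chat_relator n r).

Definition Chat (n r : nat) := Quotient.quot (Chat_rel n r).
HB.instance Definition _ n r := GRing.Zmodule.on (Chat n r).

(* [Tot_n]: the summand indexed by [r : 'I_n] has [s = n - r >= 1]. *)
Definition Tot n := dsum (fun r : 'I_n => Chat n r : zmodType).
HB.instance Definition _ n := GRing.Zmodule.on (Tot n).

(* Faces of [(g_1, ..., g_n.+1)]; in [del] and [mul] the position [j] is
   counted from 1, so that [i : 'I_n] stands for the position [i.+1]. *)
Section Faces.
Variables (n : nat) (x : {ffun 'I_n.+1 -> C}).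

Definition here (i : 'I_n) : 'I_n.+1 := widen_ord (leqnSn n) i.
Definition next (i : 'I_n) : 'I_n.+1 := lift ord0 i.

Definition act : {ffun 'I_n -> C} := [ffun i => dot (x ord0) (x (next i))].

Definition del (j : nat) : {ffun 'I_n -> C} :=
  [ffun i : 'I_n => if (i.+1 < j)%N then x (here i) else x (next i)].

Definition mul (j : nat) : {ffun 'I_n -> C} :=
  [ffun i : 'I_n => if (i.+1 < j)%N then x (here i)
                    else if i.+1 == j then x (here i) + x (next i)
                    else x (next i)].

(* the horizontal differential on a basis element of bidegree
   [(r, n.+1 - r)], for [r >= 1] *)
Definition dh (r : nat) : Dtens n :=
  delta act + \sum_(1 <= j < r) delta (mul j) *~ (-1) ^+ j
  + delta (del r) *~ (-1) ^+ r.

(* the vertical differential on a basis element of bidegree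
   [(r, n.+1 - r)], for [n.+1 - r >= 2] *)
Definition dv (r : nat) : Dtens n :=
  delta (del r.+1) *~ (-1) ^+ r.+1
  + \sum_(r.+1 <= j < n.+1) delta (mul j) *~ (-1) ^+ j.+1
  + delta (del n.+1) *~ (-1) ^+ n.+2.
End Faces.

(* The total differential, on representatives: the summand [r] of the target
   (bidegree [(r, n - r)]) receives [dh] from bidegree [(r.+1, n - r)] and [dv]
   from bidegree [(r, n.+1 - r)]. *)
Definition bd n (c : 'I_n.+1 -> Dtens n.+1) (r : 'I_n) : Dtens n :=
  zlin (fun x => dh x r.+1) (c (next r)) + zlin (fun x => dv x r) (c (here r)).

Definition Tot_class n (c : 'I_n -> Dtens n) : Tot n :=
  [ffun r : 'I_n => (\pi_(Chat n r) (c r))%qT].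

Section FullCohomology.
Variables (G : zmodType) (n : nat).

(* The differential of [Tot] is induced by [bd]: it maps [Tot_class c] to
   [Tot_class (bd c)]. Composition with it is therefore written on
   representatives. *)
Definition is_cocycleN (phi : Tot n.+1 -> G) : Prop :=
  zmod_morphism phi /\
  forall c : 'I_n.+2 -> Dtens n.+2, phi (Tot_class (bd c)) = 0.

Definition is_coboundaryN (phi : Tot n.+1 -> G) : Prop :=
  zmod_morphism phi /\
  exists2 psi : Tot n -> G, zmod_morphism psi &
    forall c : 'I_n.+1 -> Dtens n.+1,
      phi (Tot_class c) = psi (Tot_class (bd c)).

Fact cocycleN_closed : subgroup_closed is_cocycleN.
Proof.
split=> [|f g [fa f0] [ga g0]].
  by split=> [x y|c] /=; rewrite ?subr0.
have fgE x : (f - g) x = f x - g x by [].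
split=> [x y|c]; first by rewrite !fgE fa ga subrBB.
by rewrite fgE f0 g0 subr0.
Qed.

Fact coboundaryN_closed : subgroup_closed is_coboundaryN.
Proof.
split=> [|f g [fa [p pa pf]] [ga [q qa qg]]].
  have h k : zmod_morphism (0 : Tot k -> G) by move=> x y /=; rewrite subr0.
  split; first exact: h.
  exists 0; first exact: h.
  by move=> c.
have fgE x : (f - g) x = f x - g x by [].
have pqE x : (p - q) x = p x - q x by [].
split=> [x y|]; first by rewrite !fgE fa ga subrBB.
exists (p - q) => [x y|c]; first by rewrite !pqE pa qa subrBB.
by rewrite fgE pqE pf qg.
Qed.

Definition cocyclesN : zmodClosed (Tot n.+1 -> G) := subgroup cocycleN_closed.
Definition coboundariesN : zmodClosed (Tot n.+1 -> G) :=
  subgroup coboundaryN_closed.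

(* the cohomology in degree [n.+1] *)
Definition HN := subquotient cocyclesN coboundariesN.
HB.instance Definition _ := GRing.Zmodule.on HN.
End FullCohomology.

Section SmallComplex.
Variable G : zmodType.

Definition triple :=
  ({ffun C * C -> G} * {ffun C -> G} * {ffun C -> G})%type.
HB.instance Definition _ := GRing.Zmodule.on triple.

Definition is_cochainX (z : triple) : Prop :=
  let: (F, a, b) := z in
  [/\ forall i j, F (i, j) = F (j, i), forall j, F (0, j) = 0, a 0 = 0
    & b 0 = 0].

Definition cobX (theta : {ffun C -> G}) : triple :=
  ([ffun ij : C * C => theta (ij.1 + ij.2) - theta ij.1 - theta ij.2],
   [ffun i : C => theta ((1 - u%:R) * i) - theta i],
   0).

Definition is_coboundaryX (z : triple) : Prop :=
  exists2 theta : {ffun C -> G}, theta 0 = 0 & z = cobX theta.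

Definition is_cocycleX (z : triple) : Prop :=
  is_cochainX z /\
  let: (F, al, be) := z in
  [/\ forall a b c : C, F (b, c) - F (a + b, c) + F (a, b + c) - F (a, b) = 0,
      forall i j : C, al i + al j - al (i + j)
        + F ((1 - u%:R) * i, (1 - u%:R) * j) - F (i, j) = 0,
      forall i j : C, be (i + j) = be i + be j,
      forall i : C, be ((1 - u%:R) * i) = be i /\ be i *+ u = 0
    & forall i : C,
        - (\sum_(0 <= s < t) al ((1 - s%:R * u%:R) * i)) - be i
        + (\sum_(1 <= s < t) be ((1 - s%:R * u%:R) * i) *+ s) *+ u' = 0].

Fact coboundaryX_closed : subgroup_closed is_coboundaryX.
Proof.
split=> [|_ _ [f f0 ->] [g g0 ->]].
  exists 0; first by rewrite ffunE.
  by congr (_, _, _); apply/ffunP => i; rewrite !ffunE !subr0.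
exists (f - g); first by rewrite !ffunE f0 g0 subr0.
congr (_, _, _); last by rewrite /= subr0.
  by apply/ffunP => i; rewrite !ffunE [LHS]subrBB; congr (_ - _); rewrite subrBB.
by apply/ffunP => i; rewrite !ffunE subrBB.
Qed.

Fact cocycleX_closed : subgroup_closed is_cocycleX.
Proof.
split.
  split; first by split=> *; rewrite !ffunE.
  split=> *; rewrite ?ffunE ?mul0rn ?subr0 ?addr0 //.
  by rewrite !big1 => [|? _|? _]; rewrite ?ffunE ?mul0rn ?subr0 ?addr0 ?oppr0.
case=> [[F a] b] [[F' a'] b'] [[x1 x2 x3 x4] [y1 y2 y3 y4 y5]].
case=> -[x1' x2' x3' x4'] [y1' y2' y3' y4' y5'].
split.
  split=> [i j|j||]; rewrite !ffunE; first by rewrite x1 x1'.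
  - by rewrite x2 x2' subr0.
  - by rewrite x3 x3' subr0.
  - by rewrite x4 x4' subr0.
split=> [a0 b0 c0|i j|i j|i|i].
- rewrite -[RHS](subrr 0) -{1}(y1 a0 b0 c0) -(y1' a0 b0 c0) !ffunE.
  rewrite [RHS]subrBB; congr (_ - _); rewrite -[RHS]addrBB; congr (_ + _).
  by rewrite [RHS]subrBB.
- rewrite -[RHS](subrr 0) -{1}(y2 i j) -(y2' i j) !ffunE.
  rewrite [RHS]subrBB; congr (_ - _); rewrite -[RHS]addrBB; congr (_ + _).
  by rewrite [RHS]subrBB; congr (_ - _); rewrite -[RHS]addrBB.
- by rewrite !ffunE addrBB y3 y3'.
- by rewrite !ffunE mulrnBl; case: (y4 i) => -> ->; case: (y4' i) => -> ->;
    rewrite subrr.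
apply: etrans (etrans (congr2 (fun p q => p - q) (y5 i) (y5' i)) (subrr 0)).
rewrite (eq_bigr (fun s => a ((1 - s%:R * u%:R) * i)
  - a' ((1 - s%:R * u%:R) * i))); last by move=> s _; rewrite !ffunE.
rewrite [X in _ + X *+ _ = _](eq_bigr
  (fun s => b ((1 - s%:R * u%:R) * i) *+ s
    - b' ((1 - s%:R * u%:R) * i) *+ s)); last first.
  by move=> s _; rewrite !ffunE mulrnBl.
rewrite !sumrB mulrnBl !ffunE /= -[RHS]addrBB; congr (_ + _).
by rewrite [RHS]subrBB; congr (_ - _); rewrite opprB opprK addrC.
Qed.

Definition cocyclesX : zmodClosed triple := subgroup cocycleX_closed.
Definition coboundariesX : zmodClosed triple := subgroup coboundaryX_closed.

Definition H2X := subquotient cocyclesX coboundariesX.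
HB.instance Definition _ := GRing.Zmodule.on H2X.

Definition f1 (g : G) : {ffun C * C -> G} :=
  [ffun ij : C * C =>
     let i := ij.1 : nat in let j := ij.2 : nat in
     if (i == 1) && (j == 1) then g
     else if [&& 2 <= i, 2 <= j & i + j <= 5]%N then - g
     else 0].

Definition zX (g1 g1' g : G) : triple :=
  (f1 g,
   [ffun i : C => nth 0 [:: 0; g1; g1 *+ 2 - g; g1 *+ 3 - g *+ 2] i],
   [ffun i : C => g1' *+ i]).

Definition is_Zbar (z : triple) : Prop :=
  exists g1 g1' g : G, [/\ g1' *+ 2 = 0, g1 *+ 4 = g *+ 2 & z = zX g1 g1' g].

Fact Zbar_closed : subgroup_closed is_Zbar.
Proof.
split=> [|_ _ [a [b [c [b2 ac ->]]]] [a' [b' [c' [b2' ac' ->]]]]].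
  exists 0, 0, 0; split; rewrite ?mul0rn //.
  congr (_, _, _); apply/ffunP => i; rewrite !ffunE ?mul0rn //.
    by rewrite oppr0 /=; do !case: ifP.
  by rewrite !subr0; case: i => -[|[|[|[|]]]].
exists (a - a'), (b - b'), (c - c'); split.
- by rewrite mulrnBl b2 b2' subrr.
- by rewrite !mulrnBl ac ac'.
congr (_, _, _); apply/ffunP => i; rewrite !ffunE ?mulrnBl //.
  rewrite /=; case: ifP => _ //; case: ifP => _; last by rewrite subr0.
  by rewrite opprD.
by case: i => -[|[|[|[|]]]] //= _; rewrite ?subr0 ?mulrnBl // subrBB.
Qed.

Definition Zbar : zmodClosed triple := subgroup Zbar_closed.
End SmallComplex.

(* Main.v *)
(* Evaluated at (i, j) = (1, 3), (2, 1), (2, 2) and (1, 2), the identity in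
   bidegree (2, 1) shows that the component h of bidegree (1, 1) of a full
   2-cocycle is determined by alpha = h(1, -) and beta = h(2, -), with
   h(3, -) = alpha + beta; the remaining conditions on (F, alpha, beta) are those
   of the small complex. So the two groups of 2-cocycles are isomorphic, and this
   matches the coboundaries, which have h(i, -) = theta(i . -) - theta.

   In the small complex, a 1-cochain theta with prescribed theta(1) = x can be
   chosen so that F - d theta vanishes at (1, 2) and (1, 3); the cocycle
   conditions then force the cocycle into Zbar. Its parameters are
   gamma_1 = alpha(1) + F(1, 3) + 2 x, 2 gamma_1 - gamma = alpha(2) and
   gamma'_1 = beta(1), so that (gamma_1 mod 2, alpha(2), beta(1)) is a complete
   invariant of the cohomology class. *)

Require Import Defs.
From HB Require Import structures.
From mathcomp Require Import all_boot all_order all_fingroup all_algebra.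
From mathcomp Require Import boolp classical_sets functions.
From mathcomp Require Import ring.

Set Implicit Arguments.
Unset Strict Implicit.
Unset Printing Implicit Defensive.

Import GRing.Theory.
Local Open Scope ring_scope.

(* The square-zero extension [int (+) G] makes the [ring] tactic available for
   identities in an arbitrary abelian group. *)
Section SquareZeroExtension.
Variable G : zmodType.

Definition sqz := (int * G)%type.
HB.instance Definition _ := GRing.Zmodule.on sqz.

Definition sqz1 : sqz := (1, 0).
Definition sqz_mul (x y : sqz) : sqz := (x.1 * y.1, y.2 *~ x.1 + x.2 *~ y.1).

Fact sqz_mulA : associative sqz_mul.
Proof.
move=> [a x] [b y] [c z]; rewrite /sqz_mul /= mulrA; congr pair.
by rewrite !mulrzDl -!mulrzA addrA; do 2![congr (_ + _)]; congr (_ *~ _);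
  rewrite mulrC.
Qed.
Fact sqz_mulC : commutative sqz_mul.
Proof. by move=> x y; rewrite /sqz_mul mulrC addrC. Qed.
Fact sqz_mul1 : left_id sqz1 sqz_mul.
Proof. by move=> [a x]; rewrite /sqz_mul /= mul1r mulr1z mul0rz addr0. Qed.
Fact sqz_mulD : left_distributive sqz_mul +%R.
Proof.
move=> [a x] [b y] [c z]; rewrite /sqz_mul; congr pair; first exact: mulrDl.
by rewrite /= mulrzDr mulrzDl addrACA.
Qed.
Fact sqz1_neq0 : sqz1 != 0. Proof. by []. Qed.

HB.instance Definition _ := GRing.Zmodule_isComNzRing.Build sqz
  sqz_mulA sqz_mulC sqz_mul1 sqz_mulD sqz1_neq0.

Definition in_sqz (x : G) : sqz := (0, x).

Fact in_sqz_zmod_morphism : zmod_morphism in_sqz.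
Proof. by move=> x y; congr pair; rewrite /= subr0. Qed.
HB.instance Definition _ :=
  GRing.isZmodMorphism.Build G sqz in_sqz in_sqz_zmod_morphism.

Lemma in_sqz_inj : injective in_sqz. Proof. by move=> x y []. Qed.
End SquareZeroExtension.

Ltac abel := apply: in_sqz_inj; ring.

(* Proves [x = y] from an equation [a = b] and an identity left to [abel]. *)
Lemma eq_by (G : zmodType) (a b x y : G) : a = b -> x - y = a - b -> x = y.
Proof. by move=> -> /eqP; rewrite subrr subr_eq0 => /eqP. Qed.

(** * Homomorphisms out of quotient groups *)

Section QuotientIso.
Variables (V : zmodType) (I : zmodClosed V).

Lemma pi_quot_eq x y :
  (\pi_(Quotient.quot I) x = \pi_(Quotient.quot I) y)%qT <-> x - y \in I.
Proof. by rewrite Quotient.idealrBE; split=> [->|/eqP]. Qed.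

(** The first isomorphism theorem. The value of [F] on classes is recorded so that the isomorphism
    can later be compared with explicit invariants of cocycles. *)
Lemma quot_iso (W : zmodType) (f : {additive V -> W}) :
  (forall w, exists v, f v = w) -> (forall v, f v = 0 <-> v \in I) ->
  exists2 F : {additive Quotient.quot I -> W}, bijective F &
    forall v, F (\pi_(Quotient.quot I) v)%qT = f v.
Proof.
move=> /choice[g gK] kerf.
pose F (q : Quotient.quot I) := f (generic_quotient.repr q).
have Fpi v : F (\pi_(Quotient.quot I) v)%qT = f v.
  apply/eqP; rewrite -subr_eq0 -raddfB; apply/eqP/kerf/pi_quot_eq.
  by rewrite reprK.
have Fadd : zmod_morphism F.
  move=> p q; rewrite -[p]reprK -[q]reprK -(raddfB (\pi_(Quotient.quot I))%qT).
  by rewrite !Fpi raddfB.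
pose Fm := GRing.isZmodMorphism.Build _ _ F Fadd.
pose FA : {additive _ -> _} := HB.pack F Fm.
exists FA => //; exists (fun w => \pi_(Quotient.quot I) (g w))%qT => [q|w].
  rewrite /= -[q]reprK Fpi; apply/pi_quot_eq/kerf.
  by rewrite raddfB gK subrr.
by rewrite /= Fpi gK.
Qed.
End QuotientIso.

Definition mem_subgroup (V : zmodType) (S : zmodClosed V) v (vS : v \in S) :
  subgroup_type S := exist _ v vS.

Lemma eq_triple (A B C : Type) (p q : A * B * C) :
  p.1.1 = q.1.1 -> p.1.2 = q.1.2 -> p.2 = q.2 -> p = q.
Proof. by case: p q => [[a b] c] [[a' b'] c'] /= -> -> ->. Qed.

Lemma torsion_inj (G : zmodType) r : injective (val : torsion G r -> G).
Proof. exact: val_inj. Qed.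

Lemma mod_class_eq0 (G : zmodType) r (x : G) :
  mod_class r x = 0 <-> exists y, x = y *+ r.
Proof.
have := pi_quot_eq (subgroup (multiples_closed G r)) x 0.
by rewrite raddf0 subr0 => ->; split=> [/subgroupP|yx] //; apply/subgroupP.
Qed.

(** * Additive maps on free abelian groups *)

Section FreeZ.
Variables (T : finType) (V W : zmodType).
Implicit Types (F : T -> V) (c : freeZ T).

Lemma zlin_zmod_morphism F : zmod_morphism (zlin F).
Proof.
move=> c d; rewrite /zlin -sumrB; apply: eq_bigr => x _.
by rewrite !ffunE mulrzBr.
Qed.
HB.instance Definition _ F :=
  GRing.isZmodMorphism.Build (freeZ T) V (zlin F) (zlin_zmod_morphism F).

Lemma zlin_delta F x : zlin F (delta x) = F x.
Proof.
rewrite /zlin (bigD1 x) //= ffunE eqxx mulr1z big1 ?addr0 // => y /negPf yx.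
by rewrite ffunE yx mulr0z.
Qed.

Lemma zlin_comp (f : {additive V -> W}) F c : f (zlin F c) = zlin (f \o F) c.
Proof. by rewrite raddf_sum; apply: eq_bigr => x _; rewrite raddfMz. Qed.

Lemma zlin_delta_id c : zlin (@delta T) c = c.
Proof.
apply/ffunP => y; rewrite /zlin sum_ffunE (bigD1 y) //= big1 => [|x xy].
  by rewrite addr0 ffunMzE ffunE eqxx intz.
by rewrite ffunMzE ffunE eq_sym (negPf xy) mul0rz.
Qed.

Lemma additive_freeZ (f : {additive freeZ T -> V}) c :
  f c = zlin (fun x => f (delta x)) c.
Proof.
rewrite -{1}[c]zlin_delta_id raddf_sum; apply: eq_bigr => x _.
by rewrite raddfMz.
Qed.
End FreeZ.

(** * Cochains on the total complex *)

Section TotalComplex.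
Variables (n : nat) (W : zmodType).

Lemma Tot_classB (c d : 'I_n -> Dtens n) :
  Tot_class (fun i => c i - d i) = Tot_class c - Tot_class d.
Proof. by apply/ffunP => i; rewrite !ffunE raddfB. Qed.

Definition Tot_single (r : 'I_n) (c : Dtens n) : Tot n :=
  Tot_class (fun i => if i == r then c else 0).

Lemma Tot_single_zmod_morphism r : zmod_morphism (Tot_single r).
Proof.
move=> c d; rewrite /Tot_single -Tot_classB; congr Tot_class; apply/funext => i.
by case: ifP; rewrite ?subr0.
Qed.
HB.instance Definition _ r := GRing.isZmodMorphism.Build (Dtens n) (Tot n)
  (Tot_single r) (Tot_single_zmod_morphism r).

Lemma dsum_sumE (I : Type) (s : seq I) (F : I -> Tot n) i :
  (\sum_(k <- s) F k) i = \sum_(k <- s) F k i.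
Proof.
by elim/big_rec2: _ => [|k y x _ <-]; rewrite ffunE.
Qed.

Lemma Tot_class_sum c : Tot_class c = \sum_r Tot_single r (c r).
Proof.
apply/ffunP => i; rewrite dsum_sumE (bigD1 i) //= big1 => [|r ri].
  by rewrite !ffunE eqxx addr0.
by rewrite ffunE eq_sym (negPf ri) raddf0.
Qed.

Lemma Tot_class_repr (x : Tot n) :
  Tot_class (fun r => generic_quotient.repr (x r)) = x.
Proof. by apply/ffunP => i; rewrite ffunE reprK. Qed.

(** The kernel of [f] is a subgroup, and [Chat_rel] is the smallest subgroup containing the
    relators. *)
Lemma Chat_rel_kernel r (f : {additive Dtens n -> W}) :
  (forall v, Chat_relator r v -> f v = 0) ->
  forall v, v \in Chat_rel n r -> f v = 0.
Proof.
move=> f0 v /subgroupP/(_ (fun v => f v = 0)); apply=> //.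
split=> [|x y fx fy]; first exact: raddf0.
by rewrite raddfB fx fy subrr.
Qed.

(** The condition for functions on the bases, one for each bidegree, to descend to a cochain on
    [Tot n]. *)
Definition kills_relators (f : 'I_n -> {ffun 'I_n -> 'Z_4} -> W) :=
  forall (r : 'I_n) v, Chat_relator r v -> zlin (f r) v = 0.

Section Extension.
Variables (f : 'I_n -> {ffun 'I_n -> 'Z_4} -> W) (fP : kills_relators f).

Definition Tot_ext (x : Tot n) : W :=
  \sum_r zlin (f r) (generic_quotient.repr (x r)).

(** [Tot_ext] evaluates on chosen representatives; two representatives of a class differ by an
    element of [Chat_rel], on which [f] vanishes. *)
Lemma Tot_ext_class c : Tot_ext (Tot_class c) = \sum_r zlin (f r) (c r).
Proof.
apply: eq_bigr => r _; apply/eqP; rewrite -subr_eq0 -raddfB; apply/eqP.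
apply: (Chat_rel_kernel (fP (r := r))); apply/pi_quot_eq.
by rewrite reprK ffunE.
Qed.

Lemma Tot_ext_zmod_morphism : zmod_morphism Tot_ext.
Proof.
move=> x y; rewrite -[x]Tot_class_repr -[y]Tot_class_repr -Tot_classB.
rewrite !Tot_ext_class -sumrB; apply: eq_bigr => r _; exact: raddfB.
Qed.
End Extension.

Section Components.
Variables (phi : Tot n -> W) (phiP : zmod_morphism phi).

Definition component (r : 'I_n) (x : {ffun 'I_n -> 'Z_4}) : W :=
  phi (Tot_single r (delta x)).

HB.instance Definition _ := GRing.isZmodMorphism.Build (Tot n) W phi phiP.

Lemma component_single r c :
  zlin (component r) c = phi (Tot_single r c).
Proof.
have /= := additive_freeZ (phi \o Tot_single r) c.
by move=> ->.
Qed.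

Lemma component_class c :
  phi (Tot_class c) = \sum_r zlin (component r) (c r).
Proof.
rewrite Tot_class_sum raddf_sum; apply: eq_bigr => r _.
by rewrite component_single.
Qed.

(** Converse of the extension: together with [Tot_ext], it identifies additive maps on [Tot n] with
    families of functions killing the relators. *)
Lemma component_relators : kills_relators component.
Proof.
move=> r v rv; rewrite component_single -[RHS](raddf0 phi); congr phi.
apply/ffunP => i; rewrite !ffunE; case: eqP => [->|_]; last exact: raddf0.
rewrite -[RHS](raddf0 (\pi_(Chat n r))%qT); apply/pi_quot_eq.
by rewrite subr0; apply/subgroupP => P _; apply.
Qed.
End Components.
End TotalComplex.

(** * Differentials of basis elements in total degrees 2 and 3 *)

Definition vec n (s : seq 'Z_4) : {ffun 'I_n -> 'Z_4} :=
  [ffun k : 'I_n => nth 0 s k].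
Local Notation vec1 i := (vec 1 [:: i]).
Local Notation vec2 i j := (vec 2 [:: i; j]).
Local Notation vec3 i j k := (vec 3 [:: i; j; k]).

Lemma forall_ord1 (P : 'I_1 -> Prop) : P ord0 -> forall i, P i.
Proof. by move=> P0 i; rewrite ord1. Qed.
Lemma forall_ord2 (P : 'I_2 -> Prop) :
  P ord0 -> P (lift ord0 ord0) -> forall i, P i.
Proof.
move=> P0 P1 [[|[|]]] // i; [move: P0 | move: P1]; congr P; exact: val_inj.
Qed.
Lemma forall_ord3 (P : 'I_3 -> Prop) :
  P ord0 -> P (lift ord0 ord0) -> P (lift ord0 (lift ord0 ord0)) ->
  forall i, P i.
Proof.
move=> P0 P1 P2 [[|[|[|]]]] // i; [move: P0 | move: P1 | move: P2];
  congr P; exact: val_inj.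
Qed.

(** This and the next two lemmas bring the faces of a basis element, which are given pointwise, to
    the explicit form [vec]. *)
Lemma vec1P (x : {ffun 'I_1 -> 'Z_4}) : x = vec1 (x ord0).
Proof. by apply/ffunP; apply: forall_ord1; rewrite !ffunE. Qed.
Lemma vec2P (x : {ffun 'I_2 -> 'Z_4}) : x = vec2 (x ord0) (x (lift ord0 ord0)).
Proof. by apply/ffunP; apply: forall_ord2; rewrite !ffunE. Qed.
Lemma vec3P (x : {ffun 'I_3 -> 'Z_4}) :
  x = vec3 (x ord0) (x (lift ord0 ord0)) (x (lift ord0 (lift ord0 ord0))).
Proof. by apply/ffunP; apply: forall_ord3; rewrite !ffunE. Qed.

Section LowDegree.
Variable W : zmodType.

Lemma zlin_bd n (f : 'I_n -> {ffun 'I_n -> 'Z_4} -> W) c :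
  \sum_r zlin (f r) (bd c r) =
  \sum_r (zlin (fun x => zlin (f r) (dh x r.+1)) (c (Defs.next r))
          + zlin (fun x => zlin (f r) (dv x r)) (c (here r))).
Proof. by apply: eq_bigr => r _; rewrite /bd raddfD /= !zlin_comp. Qed.

Lemma mulrz_sign (x : W) :
  (x *~ (-1) ^+ 1 = - x) * (x *~ (-1) ^+ 2 = x) * (x *~ (-1) ^+ 3 = - x)
  * (x *~ (-1) ^+ 4 = x).
Proof. by do !split. Qed.

Lemma dv_vec2 (f : {ffun 'I_1 -> 'Z_4} -> W) i j :
  zlin f (dv (vec2 i j) 0) = f (vec1 (i + j)) - f (vec1 i) - f (vec1 j).
Proof.
rewrite /dv big_nat1 !(raddfD, raddfMz, mulrz_sign) /= !zlin_delta.
rewrite (vec1P (del _ 1)) (vec1P (del _ 2)) (vec1P (Defs.mul _ 1)) !ffunE /=.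
by abel.
Qed.

Lemma dh_vec2 (f : {ffun 'I_1 -> 'Z_4} -> W) i j :
  zlin f (dh (vec2 i j) 1) = f (vec1 (dot i j)) - f (vec1 j).
Proof.
rewrite /dh big_geq // addr0 !(raddfD, raddfMz, mulrz_sign) /= !zlin_delta.
by rewrite (vec1P (del _ 1)) (vec1P (Defs.act _)) !ffunE /=.
Qed.

Lemma dv_vec3_0 (f : {ffun 'I_2 -> 'Z_4} -> W) i j k :
  zlin f (dv (vec3 i j k) 0) =
  - (f (vec2 j k) - f (vec2 (i + j) k) + f (vec2 i (j + k)) - f (vec2 i j)).
Proof.
rewrite /dv big_ltn // big_nat1 !(raddfD, raddfMz, mulrz_sign) /= !zlin_delta.
rewrite (vec2P (del _ 1)) (vec2P (del _ 3)) (vec2P (Defs.mul _ 1)).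
rewrite (vec2P (Defs.mul _ 2)) !ffunE /=.
by abel.
Qed.

Lemma dv_vec3_1 (f : {ffun 'I_2 -> 'Z_4} -> W) i j k :
  zlin f (dv (vec3 i j k) 1) = f (vec2 i k) - f (vec2 i (j + k)) + f (vec2 i j).
Proof.
rewrite /dv big_nat1 !(raddfD, raddfMz, mulrz_sign) /= !zlin_delta.
rewrite (vec2P (del _ 2)) (vec2P (del _ 3)) (vec2P (Defs.mul _ 2)).
by rewrite !ffunE /=.
Qed.

Lemma dh_vec3_1 (f : {ffun 'I_2 -> 'Z_4} -> W) i j k :
  zlin f (dh (vec3 i j k) 1) = f (vec2 (dot i j) (dot i k)) - f (vec2 j k).
Proof.
rewrite /dh big_geq // addr0 !(raddfD, raddfMz, mulrz_sign) /= !zlin_delta.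
rewrite (vec2P (del _ 1)) (vec2P (Defs.act _)).
by rewrite !ffunE /=.
Qed.

Lemma dh_vec3_2 (f : {ffun 'I_2 -> 'Z_4} -> W) i j k :
  zlin f (dh (vec3 i j k) 2) =
  f (vec2 (dot i j) (dot i k)) - f (vec2 (i + j) k) + f (vec2 i k).
Proof.
rewrite /dh big_nat1 !(raddfD, raddfMz, mulrz_sign) /= !zlin_delta.
rewrite (vec2P (del _ 2)) (vec2P (Defs.act _)) (vec2P (Defs.mul _ 1)).
by rewrite !ffunE /=.
Qed.
End LowDegree.

(** * Unit and shuffle relators in total degrees 1 and 2 *)

Section Relators.
Variable W : zmodType.

Lemma tens_delta n (x : {ffun 'I_n -> 'Z_4}) :
  tens (fun k => delta (x k)) = delta x.
Proof.
apply/ffunP => y; rewrite !ffunE; case: eqP => [->|/eqP yx].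
  by rewrite big1 // => k _; rewrite ffunE eqxx.
have [k yk] : exists k, y k != x k.
  apply/existsP; apply: contraNT yx; rewrite negb_exists => /forallP yx.
  by apply/eqP/ffunP => k; have := yx k; rewrite negbK => /eqP.
by rewrite (bigD1 k) //= ffunE (negPf yk) mul0r.
Qed.

(** A basis element occurring in [tens d] has its [k]-th entry in the support of [d k], which here
    is the unit alone. *)
Lemma zlin_tens_unit n (f : {ffun 'I_n -> 'Z_4} -> W) (d : 'I_n -> D) k :
  (forall x : {ffun 'I_n -> 'Z_4}, x k = 0 -> f x = 0) -> d k = delta 0 ->
  zlin f (tens d) = 0.
Proof.
move=> fk dk; rewrite /zlin big1 // => x _; rewrite ffunE.
have [/fk ->|xk] := eqVneq (x k) 0; first by rewrite mul0rz.
by rewrite (bigD1 k) //= dk ffunE (negPf xk) mul0r mulr0z.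
Qed.

Lemma perm_ord2 (s : 'S_2) : s = 1%g \/ s = tperm ord0 (lift ord0 ord0).
Proof.
have ord2P (i j k : 'I_2) : i != k -> j != k -> i = j.
  by elim/forall_ord2: i; elim/forall_ord2: j; elim/forall_ord2: k.
have s1 : s (lift ord0 ord0) != s ord0 by apply/eqP => /perm_inj.
have [s0|s0] := eqVneq (s ord0) ord0; [left|right]; apply/permP => i.
  rewrite perm1; elim/forall_ord2: i => //.
  by apply: ord2P s1 _; rewrite s0.
have s01 : s ord0 = lift ord0 ord0 by apply: ord2P s0 _.
elim/forall_ord2: i; first by rewrite tpermL.
by rewrite tpermR; apply: ord2P s1 _; rewrite s01.
Qed.

(** Both permutations of two positions are shuffles for [l = 1], since each of the two blocks has
    one element. In bidegree (0, 2) the shuffle relation is therefore symmetry. *)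
Lemma shuffle2 (d : 'I_2 -> D) :
  shuffle 0 1 d = tens d - tens (fun k => d (tperm ord0 (lift ord0 ord0) k)).
Proof.
have isT s : is_shuffle 0 1 (s : 'S_2).
  apply/andP; split; first by apply/forallP => i; rewrite ltn0.
  apply/forallP; apply: forall_ord2; apply/forallP; apply: forall_ord2 => //.
rewrite /shuffle (bigD1 1%g) //= (bigD1 (tperm ord0 (lift ord0 ord0))) /=;
    last first.
  rewrite isT; apply/eqP => /permP/(_ ord0); rewrite tpermL perm1.
  by move=> /(congr1 val).
rewrite big1 ?addr0 => [|s /andP[/andP[_ s1] st]]; last first.
  by case: (perm_ord2 s) s1 st => ->; rewrite eqxx.
rewrite odd_perm1 odd_tperm /= expr0 mulr1z mulrN1z invg1 tpermV.
by congr (_ - _); congr tens; apply/funext => k; rewrite perm1.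
Qed.

Lemma kills_relators1 (f : 'I_1 -> {ffun 'I_1 -> 'Z_4} -> W) :
  f ord0 (vec1 0) = 0 -> kills_relators f.
Proof.
(* With a single entry no [l] satisfies [0 < l < 1], so only the unit relators remain. *)
move=> f0; apply: forall_ord1 => _ [d k dk|l d l0];
  last by rewrite ltnS leqNgt addnC addn0 l0.
apply: zlin_tens_unit dk => x; elim/forall_ord1: k => x0.
by rewrite (vec1P x) x0.
Qed.

(** The bidegrees are (0, 2) and (1, 1), and only the first has a shuffle relator. Symmetry also
    yields vanishing at [(j, 0)] there, so the last hypothesis concerns bidegree (1, 1) only. *)
Lemma kills_relators2 (f : 'I_2 -> {ffun 'I_2 -> 'Z_4} -> W) :
  (forall i j, f ord0 (vec2 i j) = f ord0 (vec2 j i)) ->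
  (forall r j, f r (vec2 0 j) = 0) ->
  (forall j, f (lift ord0 ord0) (vec2 j 0) = 0) ->
  kills_relators f.
Proof.
move=> fC f0 f1.
have unit (r : 'I_2) (x : {ffun 'I_2 -> 'Z_4}) k : x k = 0 -> f r x = 0.
  rewrite (vec2P x); elim/forall_ord2: k; rewrite ffunE /= => ->.
    exact: f0.
  by elim/forall_ord2: r; [rewrite fC; exact: f0 | exact: f1].
move=> r v [d k dk|l d l0]; first by apply: zlin_tens_unit dk => x; apply: unit.
move: r; apply: forall_ord2; rewrite ltnS; last by case: l l0.
rewrite add0n; case: l l0 => [|[|]] // _ _; rewrite shuffle2 raddfB /=.
apply/eqP; rewrite subr_eq0; apply/eqP.
(* Swapping the two entries of the basis elements matches the two tensors term by term. *)
rewrite /zlin (reindex_inj (h := fun x : {ffun 'I_2 -> 'Z_4} =>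
  vec2 (x (lift ord0 ord0)) (x ord0))) /=; last first.
  move=> x y /ffunP xy; rewrite (vec2P x) (vec2P y).
  by have := xy ord0; have := xy (lift ord0 ord0); rewrite !ffunE /= => -> ->.
apply: eq_bigr => x _; rewrite fC -vec2P; congr (_ *~ _).
rewrite !ffunE !big_ord_recl !big_ord0 !ffunE /= tpermL tpermR !mulr1.
by rewrite mulrC.
Qed.

Lemma component_unit n (phi : Tot n -> W) r (x : {ffun 'I_n -> 'Z_4}) k :
  zmod_morphism phi -> x k = 0 -> component phi r x = 0.
Proof.
move=> phiP xk; rewrite -zlin_delta; apply: component_relators => //.
by rewrite -tens_delta; apply: (@Defs.rel_unit _ _ _ k); rewrite xk.
Qed.

Lemma component_sym (phi : Tot 2 -> W) i j :
  zmod_morphism phi ->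
  component phi ord0 (vec2 i j) = component phi ord0 (vec2 j i).
Proof.
move=> phiP; rewrite -[LHS]zlin_delta -[RHS]zlin_delta.
apply/eqP; rewrite -subr_eq0 -raddfB; apply/eqP.
apply: component_relators => //.
have := @rel_shuffle 2 0 1 (fun k => delta (vec2 i j k)) isT isT.
rewrite shuffle2 tens_delta; congr (Chat_relator _ (_ - _)).
rewrite -tens_delta; congr tens; apply/funext; apply: forall_ord2.
  by rewrite tpermL !ffunE.
by rewrite tpermR !ffunE.
Qed.
End Relators.

(** * The small complex *)

Lemma Z4_ind (P : 'Z_4 -> Prop) : P 0 -> P 1 -> P 2 -> P 3 -> forall i, P i.
Proof.
by move=> P0 P1 P2 P3 [[|[|[|[|]]]]] // i;
  [move: P0 | move: P1 | move: P2 | move: P3]; congr P; apply: val_inj.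
Qed.

Lemma Z4_table :
  ((0 + 0 = 0 :> 'Z_4) * (0 + 1 = 1 :> 'Z_4) * (0 + 2 = 2 :> 'Z_4)
   * (0 + 3 = 3 :> 'Z_4) * (1 + 0 = 1 :> 'Z_4) * (1 + 1 = 2 :> 'Z_4)
   * (1 + 2 = 3 :> 'Z_4) * (1 + 3 = 0 :> 'Z_4) * (2 + 0 = 2 :> 'Z_4)
   * (2 + 1 = 3 :> 'Z_4) * (2 + 2 = 0 :> 'Z_4) * (2 + 3 = 1 :> 'Z_4)
   * (3 + 0 = 3 :> 'Z_4) * (3 + 1 = 0 :> 'Z_4) * (3 + 2 = 1 :> 'Z_4)
   * (3 + 3 = 2 :> 'Z_4))
  * ((- 0 = 0 :> 'Z_4) * (- 1 = 3 :> 'Z_4) * (- 2 = 2 :> 'Z_4)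
   * (- 3 = 1 :> 'Z_4)).
Proof. by do !split; apply: val_inj. Qed.

Lemma mul_Z4_N1 (i : 'Z_4) : (1 - 2) * i = - i.
Proof. by elim/Z4_ind: i; apply: val_inj. Qed.

(** Modulo 4, [1 - 2 * i] depends only on the parity of [i]: it is 1 or -1. *)
Lemma dot_Z4 (j : 'Z_4) :
  (dot 0 j = j) * (dot 1 j = - j) * (dot 2 j = j) * (dot 3 j = - j).
Proof. by do !split; elim/Z4_ind: j; apply: val_inj. Qed.

Section SmallComplex.
Variable G : zmodType.
Implicit Types (F : {ffun 'Z_4 * 'Z_4 -> G}) (al be th : {ffun 'Z_4 -> G}).

(** For [t = 2] and [u' = 1] the last equation also contains [- be i + be (- i)], which cancels by
    the invariance of [be] under negation. *)
Lemma cocycleXP F al be :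
  is_cocycleX (F, al, be) <-> is_cochainX (F, al, be) /\
  [/\ forall i j k, F (j, k) - F (i + j, k) + F (i, j + k) - F (i, j) = 0,
      forall i j, al i + al j - al (i + j) + F (- i, - j) - F (i, j) = 0,
      forall i j, be (i + j) = be i + be j,
      forall i, be (- i) = be i /\ be i *+ 2 = 0
    & forall i, al i + al (- i) = 0].
Proof.
have E i : - (\sum_(0 <= s < 2) al ((1 - s%:R * 2%:R) * i)) - be i
    + (\sum_(1 <= s < 2) be ((1 - s%:R * 2%:R) * i) *+ s) *+ 1
  = - (al i + al (- i)) - be i + be (- i).
  rewrite big_ltn // !big_nat1 mul0r subr0 mul1r.
  by rewrite (_ : 1%:R * 2%:R = 2) ?mul1r // mul_Z4_N1 !mulr1n.
split=> -[cz [z1 z2 z3 z4 z5]]; split=> //; split=> // i.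
- by move=> j; have := z2 i j; rewrite !mul_Z4_N1.
- by have := z4 i; rewrite mul_Z4_N1.
- by have := z5 i; have := z4 i; rewrite E mul_Z4_N1 => -[-> _];
  rewrite addrNK => /eqP; rewrite oppr_eq0 => /eqP.
- by move=> j; have := z2 i j; rewrite !mul_Z4_N1.
- by have := z4 i; rewrite mul_Z4_N1.
by rewrite E z5; have [-> _] := z4 i; rewrite oppr0 add0r addNr.
Qed.

Definition tab (g1 g2 g3 : G) : {ffun 'Z_4 -> G} :=
  [ffun i : 'Z_4 => nth 0 [:: 0; g1; g2; g3] i].

Lemma tabE g1 g2 g3 :
  (tab g1 g2 g3 0 = 0) * (tab g1 g2 g3 1 = g1) * (tab g1 g2 g3 2 = g2)
  * (tab g1 g2 g3 3 = g3).
Proof. by do !split; rewrite ffunE. Qed.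

Lemma f1_table (g : G) :
  ((forall i, f1 g (0, i) = 0) * (forall i, f1 g (i, 0) = 0)
  * (f1 g (1, 1) = g) * (f1 g (1, 2) = 0) * (f1 g (1, 3) = 0))
  * ((f1 g (2, 1) = 0) * (f1 g (2, 2) = - g) * (f1 g (2, 3) = - g))
  * ((f1 g (3, 1) = 0) * (f1 g (3, 2) = - g) * (f1 g (3, 3) = 0)).
Proof. by do !split; do ?elim/Z4_ind; rewrite ffunE. Qed.

Lemma zX_tab (g1 g1' g : G) : g1' *+ 2 = 0 ->
  zX g1 g1' g = (f1 g, tab g1 (g1 *+ 2 - g) (g1 *+ 3 - g *+ 2), tab g1' 0 g1').
Proof.
move=> g1'2; congr pair; apply/ffunP; elim/Z4_ind; rewrite tabE ffunE //.
by rewrite [LHS]mulrSr g1'2 add0r.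
Qed.

Lemma zX0 : zX 0 0 0 = 0 :> triple G.
Proof.
rewrite zX_tab ?mul0rn // !subr0 -[RHS]/(0, 0, 0).
congr (_, _, _); apply/ffunP.
- by case=> i j; elim/Z4_ind: i; elim/Z4_ind: j; rewrite f1_table ffunE ?oppr0.
- by elim/Z4_ind; rewrite tabE ffunE.
by elim/Z4_ind; rewrite tabE ffunE.
Qed.

(** A finite check: each instance is an identity of abelian groups or one of the two hypotheses,
    [g4] serving the conditions on [al] and [b2] those on [be]. *)
Lemma zX_cocycle (g1 g1' g : G) :
  g1' *+ 2 = 0 -> g1 *+ 4 = g *+ 2 -> is_cocycleX (zX g1 g1' g).
Proof.
move=> b2 g4; rewrite zX_tab //; apply/cocycleXP; split.
  split; rewrite ?tabE // => i; last by rewrite f1_table.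
  by move=> j; elim/Z4_ind: i; elim/Z4_ind: j; rewrite !f1_table.
split=> i.
- move=> j k; elim/Z4_ind: i; elim/Z4_ind: j; elim/Z4_ind: k;
  rewrite !Z4_table !f1_table; abel.
- move=> j; elim/Z4_ind: i; elim/Z4_ind: j;
  rewrite !Z4_table !f1_table !tabE; first [abel | apply: (eq_by g4); abel].
- move=> j; elim/Z4_ind: i; elim/Z4_ind: j;
  rewrite !Z4_table !tabE; first [abel | apply: (eq_by (esym b2)); abel].
- by elim/Z4_ind: i; rewrite !Z4_table !tabE ?mul0rn.
by elim/Z4_ind: i; rewrite !Z4_table !tabE;
  first [abel | apply: (eq_by g4); abel].
Qed.
End SmallComplex.

(** * Invariants of degree-2 classes of the small complex *)

Section SmallCohomology.
Variable G : zmodType.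

(* The parameter [gamma_1], well defined modulo [2 G] on cohomology classes. *)
Definition inv1 (z : triple G) : G := z.1.2 1 + z.1.1 (1, 3).

Lemma zX_inv (g1 g1' g : G) (z := zX g1 g1' g) :
  (inv1 z = g1) * (z.1.2 2 = g1 *+ 2 - g) * (z.2 1 = g1').
Proof. by rewrite /z /inv1 /= f1_table addr0 !ffunE. Qed.

(* [x] is the value at [1] of the [1]-cochain relating [z] to [Zbar]. *)
Lemma cocycleX_normal_form (z : triple G) (x : G)
    (g1 := inv1 z + x *+ 2) (g1' := z.2 1) (g := g1 *+ 2 - z.1.2 2) :
  is_cocycleX z ->
  [/\ g1' *+ 2 = 0, g1 *+ 4 = g *+ 2 &
    exists2 th : {ffun 'Z_4 -> G}, th 0 = 0 & z = zX g1 g1' g + cobX th].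
Proof.
rewrite {}/g {}/g1 {}/g1' /inv1.
case: z => [[F al] be] /cocycleXP[[FC F0 al0 be0] [cF cal cbe be2 alN]] /=.
have F0r i : F (i, 0) = 0 by rewrite FC F0.
(* Symmetry and the cocycle identity at (1, 1, 2), (1, 1, 3) and (1, 2, 3) express [F] through its
   values at (1, 1), (1, 2) and (1, 3). *)
have FE : ((F (2, 1) = F (1, 2)) * (F (3, 1) = F (1, 3))
  * (F (3, 2) = F (2, 3)))
  * (F (2, 2) = F (1, 2) + F (1, 3) - F (1, 1))
  * (F (2, 3) = F (1, 3) - F (1, 1)) * (F (3, 3) = F (1, 3) - F (1, 2)).
  have := cF 1 1 2; have := cF 1 1 3; have := cF 1 2 3.
  rewrite !Z4_table F0r => e3 e2 e1.
  have e : F (2, 3) = F (1, 3) - F (1, 1) by apply: (eq_by (esym e2)); abel.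
  do !split => //; first by apply: (eq_by (esym e1)); abel.
  by apply: (eq_by (esym e3)); rewrite e; abel.
(* The first equation gives [al 2] and the third gives [al 3]; substituted into the second, they
   leave one relation on [al 1] and [F], the source of [g4]. *)
have := cal 1 1; have := cal 1 2; have := alN 1.
rewrite !Z4_table !FE => e3 e2 e1.
have al2 : al 2 = al 1 *+ 2 + F (1, 3) - F (1, 2) - F (1, 1).
  by apply: (eq_by (esym e1)); abel.
have al3 : al 3 = - al 1 by apply: (eq_by e3); abel.
have {e1}e2 : al 1 *+ 4 = (F (1, 1) + F (1, 2) - F (1, 3)) *+ 2.
  by apply: (eq_by e2); rewrite al2 al3; abel.
have [_ b2] := be2 1.
have be_2 : be 2 = 0 by have := cbe 1 1; rewrite !Z4_table -mulr2n b2.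
have be_3 : be 3 = be 1 by have := cbe 2 1; rewrite !Z4_table be_2 add0r.
have g4 : (al 1 + F (1, 3) + x *+ 2) *+ 4 =
          ((al 1 + F (1, 3) + x *+ 2) *+ 2 - al 2) *+ 2.
  by apply: (eq_by e2); rewrite al2; abel.
split=> //.
(* With [th 1 = x], the value [th 3] is forced by the vanishing of [F - d th] at (1, 3), and then
   [th 2] by its vanishing at (1, 2). *)
exists (tab x (- F (1, 3) - F (1, 2) - x *+ 2) (- F (1, 3) - x)).
  by rewrite tabE.
rewrite zX_tab //; congr (_, _, _); apply/ffunP.
- case=> i j; rewrite [RHS]ffunE [X in _ = _ + X]ffunE /=.
  by elim/Z4_ind: i; elim/Z4_ind: j;
    rewrite !Z4_table ?F0 ?F0r !f1_table !tabE ?FE ?al2; abel.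
- elim/Z4_ind; rewrite [RHS]ffunE [X in _ = _ + X]ffunE mul_Z4_N1;
  rewrite !Z4_table !tabE ?al0 ?al2 ?al3;
  by first [abel | apply: (eq_by (esym e2)); abel].
by elim/Z4_ind; rewrite [RHS]ffunE tabE ffunE addr0.
Qed.
Lemma Zbar_cocycle : {subset Zbar G <= cocyclesX G}.
Proof.
move=> z /subgroupP[g1 [g1' [g [h2 h4 ->]]]].
by apply/subgroupP; apply: zX_cocycle.
Qed.

(** The term [F (1, 3)] in [inv1] cancels the [th 3] coming from [al 1], and [al 2] vanishes because
    [- 2 = 2] in Z/4. *)
Lemma cobX_inv (th : {ffun 'Z_4 -> G}) : th 0 = 0 ->
  (inv1 (cobX th) = (- th 1) *+ 2) * ((cobX th).1.2 2 = 0)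
  * ((cobX th).2 1 = 0).
Proof.
by move=> th0; do !split; rewrite /inv1 !ffunE ?mul_Z4_N1 ?Z4_table ?th0; abel.
Qed.

Lemma coboundaryX_inv (z : triple G) : z \in cocyclesX G ->
  z \in coboundariesX G <->
  [/\ exists y, inv1 z = y *+ 2, z.1.2 2 = 0 & z.2 1 = 0].
Proof.
move=> /subgroupP zZ; split=> [/subgroupP[th th0 ->]|[[y zy] z2 z1]].
  by rewrite !cobX_inv //; split=> //; exists (- th 1).
(* The choice [x = - y] makes the parameter [g1] of the normal form zero; the other two are then
   zero as well, and only the coboundary remains. *)
have [_ _ [th th0]] := cocycleX_normal_form (- y) zZ.
rewrite {}zy {}z2 {}z1 mulNrn subrr mul0rn subr0 zX0 add0r => zth.
by apply/subgroupP; exists th.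
Qed.

(** The equation [al i + al (- i) = 0] at the fixed point 2 of negation gives the first part. *)
Lemma torsion_inv (z : triple G) : z \in cocyclesX G ->
  (z.1.2 2 \in subgroup (torsion_closed G 2)) *
  (z.2 1 \in subgroup (torsion_closed G 2)).
Proof.
case: z => [[F al] be] /subgroupP/cocycleXP[_ [_ _ _ be2 alN]].
split; apply/subgroupP; last by case: (be2 1).
by have := alN 2; rewrite Z4_table.
Qed.

Definition invX (w : subgroup_type (cocyclesX G)) :
    (G * torsion G 2 * torsion G 2)%type :=
  (inv1 (val w), mem_subgroup (torsion_inv (valP w)).1,
   mem_subgroup (torsion_inv (valP w)).2).

Fact invX_zmod_morphism : zmod_morphism invX.
Proof.
move=> v w; apply: eq_triple; [|apply: torsion_inj; rewrite raddfB..];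
  rewrite /= ?/inv1 /= !ffunE // addrBB //.
Qed.
HB.instance Definition _ :=
  GRing.isZmodMorphism.Build _ _ invX invX_zmod_morphism.

Definition Zbar_incl (x : subgroup_type (Zbar G)) :
    subgroup_type (cocyclesX G) :=
  mem_subgroup (Zbar_cocycle (valP x)).
Fact Zbar_incl_zmod_morphism : zmod_morphism Zbar_incl.
Proof. by move=> x y; apply: val_inj. Qed.
HB.instance Definition _ :=
  GRing.isZmodMorphism.Build _ _ Zbar_incl Zbar_incl_zmod_morphism.

(** Taken as a restriction of [invX], the map is additive without computation; the explicit formula
    is [Theta_zX]. *)
Definition Theta := invX \o Zbar_incl.
HB.instance Definition _ := GRing.Additive.on Theta.

(** The inverse of [Theta]: the equation [y = g1 *+ 2 - g] is solved for [g], and [y *+ 2 = 0]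
    becomes [g1 *+ 4 = g *+ 2]. *)
Lemma zX_Zbar (p : (G * torsion G 2 * torsion G 2)%type) :
  zX p.1.1 (val p.2) (p.1.1 *+ 2 - val p.1.2) \in Zbar G.
Proof.
case: p => [[g1 [y /= /subgroupP y2]] [x /= /subgroupP x2]]; apply/subgroupP.
by exists g1, x, (g1 *+ 2 - y); split=> //; apply: (eq_by y2); abel.
Qed.

Lemma Theta_zX (x : subgroup_type (Zbar G)) (g1 g1' g : G) :
  val x = zX g1 g1' g ->
  [/\ (Theta x).1.1 = g1, val (Theta x).1.2 = g1 *+ 2 - g
    & val (Theta x).2 = g1'].
Proof. by move=> xE; rewrite /= xE !zX_inv. Qed.

Lemma Theta_bij : bijective Theta.
Proof.
exists (fun p => mem_subgroup (zX_Zbar p)) => [x|p].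
  apply: val_inj; have /subgroupP[g1 [g1' [g [_ _ xE]]]] := valP x.
  have [e1 e2 e3] := Theta_zX xE.
  transitivity (zX (Theta x).1.1 (val (Theta x).2)
    ((Theta x).1.1 *+ 2 - val (Theta x).1.2)) => //.
  by rewrite e1 e2 e3 subKr.
have [e1 e2 e3] := @Theta_zX (mem_subgroup (zX_Zbar p)) _ _ _ erefl.
case: p e1 e2 e3 => [[p1 p2] p3] /= e1 e2 e3.
by apply: eq_triple; [|apply: torsion_inj..]; rewrite // [LHS]e2 subKr.
Qed.

Definition reduce (p : (G * torsion G 2 * torsion G 2)%type) :
  (mod_multiples G 2 * torsion G 2 * torsion G 2)%type :=
  (mod_class 2 p.1.1, p.1.2, p.2).
Fact reduce_zmod_morphism : zmod_morphism reduce.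
Proof. by move=> p q; apply: eq_triple; rewrite //= /mod_class raddfB. Qed.
HB.instance Definition _ :=
  GRing.isZmodMorphism.Build _ _ reduce reduce_zmod_morphism.

Lemma reduce_surj p : exists q, reduce q = p.
Proof.
case: p => [[c t] t']; exists (generic_quotient.repr c, t, t').
by rewrite /reduce /mod_class reprK.
Qed.

Lemma reduce_eq0 p : reduce p = 0 <->
  [/\ exists y, p.1.1 = y *+ 2, val p.1.2 = 0 & val p.2 = 0].
Proof.
split=> [[/= /mod_class_eq0 p0 -> ->]|[p0 p1 p2]].
  by split=> //; exact: raddf0.
apply: eq_triple; [exact/mod_class_eq0|apply: torsion_inj..].
  by rewrite p1 raddf0.
by rewrite p2 raddf0.
Qed.

(** The composite [reduce \o invX] is onto already on [Zbar], by [Theta_bij], and its kernel is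
    given by [coboundaryX_inv]. *)
Lemma H2X_iso : exists2 Phi :
    {additive H2X G -> (mod_multiples G 2 * torsion G 2 * torsion G 2)%type},
  bijective Phi &
    forall w, Phi (class_of (coboundariesX G) w) = reduce (invX w).
Proof.
apply: (quot_iso (f := reduce \o invX)) => [p|w].
  have [q <-] := reduce_surj p; have [g _ gK] := Theta_bij.
  by exists (Zbar_incl (g q)); rewrite -[in RHS](gK q).
rewrite [_ w]/= reduce_eq0 /=; split => [|wB].
  by case: (coboundaryX_inv (valP w)) => _ wB /wB ?; apply/subgroupP.
by case: (coboundaryX_inv (valP w)) => h _; apply: h; move/subgroupP: wB.
Qed.

(** On [Zbar] the criterion [coboundaryX_inv] says that [g1] is a double, [g = g1 *+ 2] and
    [g1' = 0]. *)
Lemma Zbar_coboundary (z : triple G) :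
  z \in Zbar G /\ z \in coboundariesX G <->
  exists g : G, z = zX (g *+ 2) 0 (g *+ 4).
Proof.
split=> [[/[dup] zZ /subgroupP[g1 [g1' [g [_ _ zE]]]]]|[g ->]].
  move/coboundaryX_inv => /(_ (Zbar_cocycle zZ)).
  rewrite zE !zX_inv => -[[y ->] /eqP]; rewrite subr_eq0 => /eqP <- ->.
  by exists y; congr zX; abel.
have zZ : zX (g *+ 2) 0 (g *+ 4) \in Zbar G.
  apply/subgroupP; exists (g *+ 2), 0, (g *+ 4).
  by split=> //; [rewrite mul0rn | abel].
split=> //; apply/coboundaryX_inv; first exact: Zbar_cocycle.
by rewrite !zX_inv; split=> //; [exists g | abel].
Qed.
End SmallCohomology.

(** * Comparison with the full complex *)

Section FullComplex.
Variable W : zmodType.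

Lemma zlinDl (T : finType) (f g : T -> W) (c : freeZ T) :
  zlin f c + zlin g c = zlin (fun x => f x + g x) c.
Proof.
by rewrite /zlin -big_split; apply: eq_bigr => x _; rewrite mulrzDl.
Qed.

Lemma eq_zlin (T : finType) (f g : T -> W) (c : freeZ T) :
  f =1 g -> zlin f c = zlin g c.
Proof. by move=> fg; apply: eq_bigr => x _; rewrite fg. Qed.

(** A single basis element placed in a single summand isolates one value of the family. *)
Lemma sum_zlin_inj n (f g : 'I_n -> {ffun 'I_n -> 'Z_4} -> W) :
  (forall c : 'I_n -> Dtens n,
     \sum_r zlin (f r) (c r) = \sum_r zlin (g r) (c r)) <->
  (forall r x, f r x = g r x).
Proof.
split=> [fg r x|fg c]; last by apply: eq_bigr => r _; apply: eq_zlin.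
have E (h : 'I_n -> {ffun 'I_n -> 'Z_4} -> W) :
    \sum_s zlin (h s) (if s == r then delta x else 0) = h r x.
  rewrite (bigD1 r) //= eqxx zlin_delta big1 ?addr0 // => s /negPf ->.
  exact: raddf0.
by rewrite -(E f) -(E g).
Qed.

Definition cob1 (g : 'I_1 -> {ffun 'I_1 -> 'Z_4} -> W) (r : 'I_2)
    (x : {ffun 'I_2 -> 'Z_4}) : W :=
  if r == ord0 then zlin (g ord0) (dv x 0) else zlin (g ord0) (dh x 1).

(** The transpose of [bd] on families of functions; the list runs over the bidegrees (0, 3), (1, 2)
    and (2, 1). *)
Definition cob2 (f : 'I_2 -> {ffun 'I_2 -> 'Z_4} -> W) (r : 'I_3)
    (x : {ffun 'I_3 -> 'Z_4}) : W :=
  nth 0 [:: zlin (f ord0) (dv x 0);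
    zlin (f ord0) (dh x 1) + zlin (f (lift ord0 ord0)) (dv x 1);
    zlin (f (lift ord0 ord0)) (dh x 2)] r.

Lemma here_ord0 n : here (ord0 : 'I_n.+1) = ord0. Proof. exact: val_inj. Qed.

Lemma zlin_bd1 g (c : 'I_2 -> Dtens 2) :
  \sum_r zlin (g r) (bd c r) = \sum_r zlin (cob1 g r) (c r).
Proof.
by rewrite zlin_bd !big_ord_recl !big_ord0 here_ord0 /= !addr0 addrC.
Qed.

Lemma zlin_bd2 f (c : 'I_3 -> Dtens 3) :
  \sum_r zlin (f r) (bd c r) = \sum_r zlin (cob2 f r) (c r).
Proof.
rewrite zlin_bd !big_ord_recl !big_ord0 here_ord0 /= /cob2 /= -zlinDl.
have -> : here (lift ord0 ord0 : 'I_2) = lift ord0 ord0 by apply: val_inj.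
by rewrite !addr0 [X in X + _ = _]addrC [X in _ + X = _]addrC -!addrA.
Qed.

Section Cocycle.
Variable f : 'I_2 -> {ffun 'I_2 -> 'Z_4} -> W.
Let F i j := f ord0 (vec2 i j).
Let h i j := f (lift ord0 ord0) (vec2 i j).

Lemma cob2_eq0 : (forall r x, cob2 f r x = 0) <->
  [/\ forall i j k, F j k - F (i + j) k + F i (j + k) - F i j = 0,
      forall i j k, F (dot i j) (dot i k) - F j k
        + (h i k - h i (j + k) + h i j) = 0
    & forall i j k, h (dot i j) (dot i k) - h (i + j) k + h i k = 0].
Proof.
split=> [f0|[f0 f1 f2]].
  split=> i j k.
  - have := f0 ord0 (vec3 i j k); rewrite /cob2 /= dv_vec3_0 => /eqP.
    by rewrite oppr_eq0 => /eqP.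
  - have := f0 (lift ord0 ord0) (vec3 i j k).
    by rewrite /cob2 /= dv_vec3_1 dh_vec3_1.
  have := f0 (lift ord0 (lift ord0 ord0)) (vec3 i j k).
  by rewrite /cob2 /= dh_vec3_2.
move=> r x; rewrite (vec3P x) /cob2; elim/forall_ord3: r => /=.
- by rewrite dv_vec3_0 [X in - X]f0 oppr0.
- by rewrite dv_vec3_1 dh_vec3_1; apply: f1.
by rewrite dh_vec3_2; apply: f2.
Qed.
End Cocycle.
End FullComplex.

(** * Degree-2 cocycles and coboundaries of the full complex as triples *)

Section FullCohomology.
Variable G : zmodType.

Definition toX (phi : Tot 2 -> G) : triple G :=
  ([ffun ij : 'Z_4 * 'Z_4 => component phi ord0 (vec2 ij.1 ij.2)],
   [ffun i : 'Z_4 => component phi (lift ord0 ord0) (vec2 1 i)],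
   [ffun i : 'Z_4 => component phi (lift ord0 ord0) (vec2 2 i)]).

Lemma cocycleN_cob (phi : Tot 2 -> G) : is_cocycleN phi <->
  zmod_morphism phi /\ forall r x, cob2 (component phi) r x = 0.
Proof.
split=> -[phiP phi0]; split=> //.
  apply/(sum_zlin_inj _ (fun _ _ => 0)) => c.
  rewrite -zlin_bd2 -component_class // phi0 big1 // => r _.
  by rewrite /zlin big1 // => x _; rewrite mul0rz.
move=> c; rewrite component_class // zlin_bd2 big1 // => r _.
by rewrite /zlin big1 // => x _; rewrite phi0 mul0rz.
Qed.

Lemma horizontal_cocycle (h : 'Z_4 -> 'Z_4 -> G) :
  (forall j, h 0 j = 0) ->
  (forall i j k, h (dot i j) (dot i k) - h (i + j) k + h i k = 0) <->
  [/\ forall k, h 1 k + h 1 (- k) = 0,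
      forall k, h 2 (- k) = h 2 k /\ h 2 k *+ 2 = 0
    & forall k, h 3 k = h 1 k + h 2 k].
Proof.
move=> h0; split=> [H|[H1 H2 H3] i j k].
  have h3 k : h 3 k = h 1 k + h 2 k.
    have := H 2 1 k; rewrite !dot_Z4 Z4_table => e.
    by apply: (eq_by (esym e)); abel.
  have h1 k : h 1 k + h 1 (- k) = 0.
    by have := H 1 3 k; rewrite !dot_Z4 !Z4_table h0 subr0 addrC.
  split=> // k; split.
    have := H 1 2 k; rewrite !dot_Z4 !Z4_table h3 => e.
    by apply: (eq_by e); abel.
  by have := H 2 2 k; rewrite !dot_Z4 Z4_table h0 subr0.
have H1' l : h 1 (- l) = - h 1 l by apply: (eq_by (H1 l)); abel.
(* Each of the 16 instances becomes an identity in [h 1 k] and [h 2 k], or [h 2 k *+ 2 = 0]. *)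
elim/Z4_ind: i; elim/Z4_ind: j;
  rewrite ?dot_Z4 ?Z4_table ?h0 ?H3 ?H1' ?(H2 k).1;
  by first [abel | apply: (eq_by (H2 k).2); abel].
Qed.

(** The equation in bidegree (1, 2) at [i = 1] is the condition linking [al] and [F]; at [i = 2],
    which acts trivially, it is the additivity of [be]. *)
Lemma toX_cocycle (phi : Tot 2 -> G) : is_cocycleN phi -> is_cocycleX (toX phi).
Proof.
case/cocycleN_cob => phiP /cob2_eq0[F3 Fh Hh].
have fC := component_sym _ _ phiP.
have f0 r j : component phi r (vec2 0 j) = 0.
  by apply: (@component_unit _ _ _ _ _ ord0); rewrite // ffunE.
have f1 r j : component phi r (vec2 j 0) = 0.
  by apply: (@component_unit _ _ _ _ _ (lift ord0 ord0)); rewrite // ffunE.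
have [h1 h2 _] := (horizontal_cocycle (f0 (lift ord0 ord0))).1 Hh.
rewrite /toX.
move: (component phi) F3 Fh h1 h2 fC f0 f1 => f F3 Fh h1 h2 fC f0 f1.
apply/cocycleXP; split; first by split=> *; rewrite !ffunE ?f0 ?f1 // fC.
split=> [i j k|i j|i j|i|i]; rewrite !ffunE //=.
- by have := Fh 1 i j; rewrite !dot_Z4 => e; apply: (eq_by e); abel.
- by have := Fh 2 i j; rewrite !dot_Z4 => e; apply: (eq_by (esym e)); abel.
Qed.

(** The inverse of [toX]: row 0 vanishes by normalization, and row 3 is forced by the equation in
    bidegree (2, 1). *)
Definition fromX (z : triple G) (r : 'I_2) (x : {ffun 'I_2 -> 'Z_4}) : G :=
  let j := x (lift ord0 ord0) in
  if r == ord0 then z.1.1 (x ord0, j)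
  else nth 0 [:: 0; z.1.2 j; z.2 j; z.1.2 j + z.2 j] (x ord0).

Lemma fromX_vec2 z j :
  ((forall i, fromX z ord0 (vec2 i j) = z.1.1 (i, j)) *
  (fromX z (lift ord0 ord0) (vec2 0 j) = 0) *
  (fromX z (lift ord0 ord0) (vec2 1 j) = z.1.2 j)) *
  ((fromX z (lift ord0 ord0) (vec2 2 j) = z.2 j) *
  (fromX z (lift ord0 ord0) (vec2 3 j) = z.1.2 j + z.2 j)).
Proof. by do !split => *; rewrite /fromX !ffunE. Qed.

Lemma fromX_relators z : is_cochainX z -> kills_relators (fromX z).
Proof.
case: z => [[F al] be] [FC F0 al0 be0]; apply: kills_relators2.
- by move=> i j; rewrite !fromX_vec2 /= FC.
- by move=> r j; elim/forall_ord2: r; rewrite !fromX_vec2 /= ?F0.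
by move=> j; elim/Z4_ind: j; rewrite fromX_vec2 /= ?al0 ?be0 ?addr0.
Qed.

Lemma fromX_cocycle z : is_cocycleX z -> is_cocycleN (Tot_ext (fromX z)).
Proof.
move=> zZ; have zP : kills_relators (fromX z).
  by apply: fromX_relators; case: zZ.
split; first exact: Tot_ext_zmod_morphism.
move=> c; rewrite Tot_ext_class // zlin_bd2 big1 // => r _.
rewrite /zlin big1 // => x _; rewrite (_ : cob2 _ _ _ = 0) ?mul0rz //.
move: r x; case: z zZ zP => [[F al] be] /cocycleXP[_ [F3 Fal bD be2 alN]] _.
apply/cob2_eq0; split=> [i j k|i j k|].
- by rewrite !fromX_vec2 F3.
(* Row 0 is trivial, row 1 is the equation for [al], row 2 the additivity of [be], and row 3 their
   sum. *)
- elim/Z4_ind: i; rewrite !dot_Z4 !fromX_vec2 /= ?bD; last 1 first.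
  + by apply: (eq_by (Fal j k)); abel.
  + abel.
  + by apply: (eq_by (Fal j k)); abel.
  + abel.
apply/horizontal_cocycle => [j|]; first by rewrite fromX_vec2.
by split=> k; rewrite !fromX_vec2.
Qed.

Lemma toX_ext z : is_cocycleX z -> toX (Tot_ext (fromX z)) = z.
Proof.
move=> zZ; have zP : kills_relators (fromX z).
  by apply: fromX_relators; case: zZ.
have E : forall r x, component (Tot_ext (fromX z)) r x = fromX z r x.
  apply/sum_zlin_inj => c; rewrite -component_class ?Tot_ext_class //.
  exact: Tot_ext_zmod_morphism.
by apply: eq_triple; apply/ffunP => i; rewrite ffunE E fromX_vec2 //; case: i.
Qed.

(** [Tot 1] has only the bidegree (0, 1), so a 1-cochain is a single normalized function [th]. *)
Lemma coboundaryN_components (phi : Tot 2 -> G) : is_coboundaryN phi <->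
  zmod_morphism phi /\ exists2 th : 'Z_4 -> G, th 0 = 0 & forall i j,
    component phi ord0 (vec2 i j) = th (i + j) - th i - th j /\
    component phi (lift ord0 ord0) (vec2 i j) = th (dot i j) - th j.
Proof.
split=> [[phiP [psi psiP phiE]]|[phiP [th th0 E]]]; split=> //.
  exists (fun i => component psi ord0 (vec1 i)).
    by apply: (@component_unit _ _ _ _ _ ord0); rewrite // ffunE.
  have E : forall r x, component phi r x = cob1 (component psi) r x.
    by apply/sum_zlin_inj => c; rewrite -zlin_bd1 -!component_class.
  by move=> i j; rewrite !E /cob1 /= dv_vec2 dh_vec2.
pose g (r : 'I_1) (x : {ffun 'I_1 -> 'Z_4}) := th (x ord0).
have gP : kills_relators g by apply: kills_relators1; rewrite /g ffunE.
exists (Tot_ext g); first exact: Tot_ext_zmod_morphism.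
move=> c; rewrite component_class // Tot_ext_class // zlin_bd1.
move: c; apply/sum_zlin_inj => r x; rewrite (vec2P x) /cob1.
have [e0 e1] := E (x ord0) (x (lift ord0 ord0)).
by elim/forall_ord2: r; rewrite /= ?dv_vec2 ?dh_vec2 ?e0 ?e1 /g !ffunE.
Qed.

(** A triple records only rows 1 and 2 of the component in bidegree (1, 1). The cocycle condition
    determines row 3 and normalization row 0, and both agree with [th (dot i j) - th j]. *)
Lemma toX_coboundary (phi : Tot 2 -> G) : is_cocycleN phi ->
  is_coboundaryX (toX phi) <-> is_coboundaryN phi.
Proof.
move=> phiZ; rewrite coboundaryN_components; have [phiP _] := phiZ.
split=> [[th th0 e]|[_ [th th0 E]]].
  split=> //; exists th => // i j; split.
    by have /ffunP/(_ (i, j)) := congr1 (fun z => z.1.1) e; rewrite !ffunE.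
  have /cocycleN_cob[_ /cob2_eq0[_ _ /horizontal_cocycle[|_ _ h3]]] := phiZ.
    by move=> k; apply: (@component_unit _ _ _ _ _ ord0); rewrite // ffunE.
  have h1 : component phi (lift ord0 ord0) (vec2 1 j) = th (- j) - th j.
    have /ffunP/(_ j) := congr1 (fun z => z.1.2) e.
    by rewrite !ffunE mul_Z4_N1.
  have h2 : component phi (lift ord0 ord0) (vec2 2 j) = 0.
    by have /ffunP/(_ j) := congr1 snd e; rewrite !ffunE.
  elim/Z4_ind: i; rewrite dot_Z4 ?h3 ?h1 ?h2 ?addr0 ?subrr //.
  by apply: (@component_unit _ _ _ _ _ ord0); rewrite // ffunE.
exists [ffun i => th i]; first by rewrite ffunE.
apply: eq_triple; apply/ffunP => i; rewrite !ffunE.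
- exact: (E _ _).1.
- by rewrite (E _ _).2 dot_Z4 mul_Z4_N1.
- by rewrite (E _ _).2 dot_Z4 subrr.
Qed.

Lemma toX_mem (phi : Tot 2 -> G) :
  phi \in cocyclesN G 1 -> toX phi \in cocyclesX G.
Proof. by move/subgroupP/toX_cocycle => ?; apply/subgroupP. Qed.

Definition toX_class (phi : subgroup_type (cocyclesN G 1)) : H2X G :=
  class_of (coboundariesX G) (mem_subgroup (toX_mem (valP phi))).

Fact toX_class_zmod_morphism : zmod_morphism toX_class.
Proof.
move=> phi psi; rewrite /toX_class /class_of -raddfB; congr (\pi_(_) _)%qT.
apply: val_inj; rewrite [RHS]raddfB.
have -> : val (mem_subgroup (toX_mem (valP (phi - psi)))) =
    toX (val phi - val psi).
  by rewrite -raddfB.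
by apply: eq_triple; apply/ffunP => i; rewrite !ffunE.
Qed.
HB.instance Definition _ :=
  GRing.isZmodMorphism.Build _ _ toX_class toX_class_zmod_morphism.

(** Surjectivity of [toX_class] comes from [fromX] and [toX_ext], and its kernel from
    [toX_coboundary]. *)
Lemma HN_iso : zmod_iso (HN G 1) (H2X G).
Proof.
have [w|phi|F Fbij _] :=
    quot_iso (f := toX_class) (I :=
      restr (cocyclesN G 1) (coboundariesN G 1));
    last by exists F.
  have zZ := elimT (subgroupP _ _) (valP (generic_quotient.repr w)).
  have phiZ : Tot_ext (fromX (val (generic_quotient.repr w))) \in cocyclesN G 1.
    exact/subgroupP/fromX_cocycle.
  exists (mem_subgroup phiZ); rewrite -[RHS]reprK; congr (\pi_(_) _)%qT.
  by apply: val_inj; apply: toX_ext.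
have phiZ := elimT (subgroupP _ _) (valP phi).
have := pi_quot_eq (restr (cocyclesX G) (coboundariesX G))
  (mem_subgroup (toX_mem (valP phi))) 0.
rewrite raddf0 subr0 => e.
rewrite /toX_class /class_of e; split=> /subgroupP/subgroupP.
  by move/(toX_coboundary phiZ) => ?; apply/subgroupP/subgroupP.
by move/(toX_coboundary phiZ) => ?; apply/subgroupP/subgroupP.
Qed.
End FullCohomology.

Theorem theorem3p18 (G : zmodType) :
  [/\ zmod_iso (HN G 1) (H2X G)
    & zmod_iso (H2X G) (mod_multiples G 2 * torsion G 2 * torsion G 2)%type]
  /\
  [/\ zmod_closed (Zbar G) /\ {subset Zbar G <= cocyclesX G},
      forall c : H2X G,
        exists2 w : subgroup_type (cocyclesX G), val w \in Zbar G
                                               & class_of _ w = c,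
      forall z : triple G,
        z \in Zbar G /\ z \in coboundariesX G <->
        exists g : G, z = zX (g *+ 2) 0 (g *+ 4)
    & exists Theta :
        {additive subgroup_type (Zbar G) -> (G * torsion G 2 * torsion G 2)%type},
        [/\ forall (x : subgroup_type (Zbar G)) (g1 g1' g : G),
              g1' *+ 2 = 0 -> g1 *+ 4 = g *+ 2 -> val x = zX g1 g1' g ->
              [/\ (Theta x).1.1 = g1, val (Theta x).1.2 = g1 *+ 2 - g
                & val (Theta x).2 = g1'],
            bijective Theta
          & exists2 Phi :
              {additive H2X G ->
                 (mod_multiples G 2 * torsion G 2 * torsion G 2)%type},
              bijective Phi
            & forall (x : subgroup_type (Zbar G))
                     (w : subgroup_type (cocyclesX G)),
                val w = val x ->
                Phi (class_of (coboundariesX G) w) =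
                  (mod_class 2 (Theta x).1.1, (Theta x).1.2, (Theta x).2)]].
Proof.
have [Phi Phi_bij PhiE] := H2X_iso G.
split.
  split; first exact: HN_iso.
  by exists Phi.
split.
- split; last exact: Zbar_cocycle.
  exact: sgpred_zmod_closed.
- move=> c; have [g _ gK] := Theta_bij G.
  (* The element of [Zbar] with invariants [q] has the same image under [Phi] as [c], and [Phi] is
     injective. *)
  have [q qE] := reduce_surj (Phi c); exists (Zbar_incl (g q)).
    exact: valP (g q).
  apply: (bij_inj Phi_bij); rewrite PhiE -qE; congr reduce.
  by rewrite -[RHS](gK q).
- exact: Zbar_coboundary.
exists (@Theta G : {additive _ -> _}); split.
- by move=> x g1 g1' g _ _; apply: Theta_zX.
- exact: Theta_bij.
exists Phi => // x w wx; rewrite PhiE.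
by rewrite (_ : w = Zbar_incl x) //; apply: val_inj.
Qed.
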